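(* Let $R$ be a $\phi$-ring. Then the following assertions are equivalent: (1) $R$ is a $\phi$-Prüfer ring. (2) Every finitely generated nonnil ideal $I$ of $R$ is locally principal (i.e. $I R_{\mathfrak m}$ is a principal ideal of $R_{\mathfrak m}$ for every maximal ideal $\mathfrak m$ of $R$). (3) Every non-nilpotent element $f$ of $R[X]$ is Gaussian. (4) $c(fg) = c(f)c(g)$ for all non-nilpotent elements $f, g$ of $R[X]$.
   Context: All rings are commutative with nonzero identity. For a ring $R$, $\mathrm{Nil}(R)$ denotes the ideal of nilpotent elements, $Z(R)$ the set of zerodivisors and $T(R)$ the total quotient ring. For $f \in R[X]$, the content $c(f)$ is the ideal of $R$ generated by the coefficients of $f$; $f$ is called Gaussian if $c(fg) = c(f)c(g)$ for every $g \in R[X]$. A prime ideal $P$ of $R$ is called divided if it is comparable (under inclusion) to every ideal of $R$. $R$ is a $\phi$-ring if $\mathrm{Nil}(R)$ is a divided prime ideal of $R$. An ideal $I$ of $R$ is nonnil if $I \not\subseteq \mathrm{Nil}(R)$. For a $\phi$-ring $R$, let $\phi: T(R) \to R_{\mathrm{Nil}(R)}$ be the ring homomorphism $\phi(a/b) = a/b$ for $a\in R$, $b \in R\setminus Z(R)$; restricted to $R$ it is the ring homomorphism $x \mapsto x/1$, with image the ring $\phi(R)$. A nonnil ideal $I$ of a $\phi$-ring $R$ is $\phi$-invertible if $\phi(I)$ is an invertible ideal of $\phi(R)$, i.e. $\phi(I)\,\phi(I)^{-1} = \phi(R)$ where $\phi(I)^{-1} = \{x \in T(\phi(R)) : x\phi(I)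 \subseteq \phi(R)\}$. A $\phi$-ring $R$ is $\phi$-Prüfer if every finitely generated nonnil ideal of $R$ is $\phi$-invertible. *)

(* Defs.v *)
From HB Require Import structures.
From mathcomp Require Import all_boot all_algebra.
From mathcomp Require Import ring.
From mathcomp Require Import boolp classical_sets.

Set Implicit Arguments.
Unset Strict Implicit.
Unset Printing Implicit Defensive.

Import GRing.Theory.
Local Open Scope quotient_scope.
Local Open Scope classical_set_scope.
Local Open Scope ring_scope.

(* The auxiliary notions are stated for [comPzRingType], which does not exclude
   the zero ring: localizations and images of morphisms then need no
   nontriviality proof. *)

Section Ideals.
Variable R : comPzRingType.
Implicit Types (I J P M : set R) (a x y : R).

Definition is_ideal I :=
  I 0 /\ forall a x y, I x -> I y -> I (a * x + y).

Definition ideal_gen (A : set R) : set R := smallest is_ideal A.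

Definition ideal_mul I J : set R := ideal_gen [set x * y | x in I & y in J].

Definition is_fg I := exists s : seq R, I = ideal_gen [set` s].

Definition is_principal I := exists x, I = ideal_gen [set x].

Definition is_prime P :=
  [/\ is_ideal P, ~ P 1 & forall x y, P (x * y) -> P x \/ P y].

Definition is_maximal M :=
  [/\ is_ideal M, ~ M 1 &
      forall J, is_ideal J -> M `<=` J -> J = M \/ J = setT].

Definition is_divided P :=
  is_prime P /\ forall I, is_ideal I -> P `<=` I \/ I `<=` P.

Definition nilrad : set R := [set x | exists n : nat, x ^+ n = 0].

Definition Zdiv : set R := [set x | exists2 y, y != 0 & x * y = 0].

Definition is_nonnil I := ~ I `<=` nilrad.

Definition is_phi_ring := is_divided nilrad.

Lemma is_maximal_prime M : is_maximal M -> is_prime M.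
Proof.
move=> [idM M1 Mmax]; split=> // x y Mxy; have [M0 MD] := idM.
have [Mx|nMx] := pselect (M x); [by left|right].
pose J := [set z | exists a m, M m /\ z = a * x + m].
have idJ : is_ideal J.
  split; first by exists 0, 0; split=> //; rewrite mul0r addr0.
  move=> a _ _ [b [m [Mm ->]]] [c [n [Mn ->]]].
  exists (a * b + c), (a * m + n); split; first exact: MD.
  by rewrite mulrDr mulrDl mulrA addrACA.
have MJ : M `<=` J by move=> z Mz; exists 0, z; rewrite mul0r add0r.
have Jx : J x by exists 1, 0; rewrite mul1r addr0.
have [JM|JT] := Mmax J idJ MJ; first by case: nMx; rewrite -JM.
have [a [m [Mm E]]] : J 1 by rewrite JT.
have -> : y = a * (x * y) + (y * m + 0).
  by rewrite addr0 [y * m]mulrC mulrA -mulrDl -E mul1r.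
by apply: (MD) => //; apply: (MD).
Qed.

End Ideals.

Arguments nilrad : clear implicits.
Arguments Zdiv : clear implicits.
Arguments is_phi_ring : clear implicits.

Record mulset (R : comPzRingType) := MulSet {
  mset :> set R;
  mset1 : mset 1;
  msetM : forall x y, mset x -> mset y -> mset (x * y) }.

Section Localization.
Variables (R : comPzRingType) (S : mulset R).

Definition loc_pair := {x : R * R | x.2 \in mset S}.

Definition mkpair (a s : R) (Ss : mset S s) : loc_pair :=
  exist _ (a, s) (mem_set Ss).

Implicit Types p q r : loc_pair.
Local Notation num p := (sval p).1.
Local Notation den p := (sval p).2.

Lemma denP p : mset S (den p).
Proof. exact: set_mem (svalP p). Qed.

Definition loc_eqv p q : bool :=
  `[< exists2 u, mset S u & u * (den q * num p) = u * (den p * num q) >].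

Lemma loc_eqv_refl : reflexive loc_eqv.
Proof. by move=> p; apply/asboolP; exists 1 => //; exact: mset1. Qed.

Lemma loc_eqv_sym : symmetric loc_eqv.
Proof.
by move=> p q; apply/idP/idP => /asboolP[u Su E]; apply/asboolP; exists u.
Qed.

Lemma loc_eqv_trans : transitive loc_eqv.
Proof.
move=> q p r /asboolP[u Su E] /asboolP[v Sv F]; apply/asboolP.
exists (u * v * den q); first exact: msetM (msetM Su Sv) (denP q).
transitivity (v * den r * (u * (den q * num p))); first by ring.
rewrite E; transitivity (u * den p * (v * (den r * num q))); first by ring.
by rewrite F; ring.
Qed.

Canonical loc_equiv := EquivRel loc_eqv loc_eqv_refl loc_eqv_sym loc_eqv_trans.

(* Elements are classes of fractions [a / s] with [s] in [S], where
   [a / s = b / t] iff [u * (t * a) = u * (s * b)] for some [u] in [S]. *)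
Definition loc := {eq_quot loc_eqv}.

HB.instance Definition _ := EqQuotient.on loc.
HB.instance Definition _ := Choice.on loc.

Definition mkloc (a s : R) (Ss : mset S s) : loc := \pi_loc (mkpair a Ss).

Lemma mkloc_eq a s (Ss : mset S s) b t (St : mset S t) :
  mkloc a Ss = mkloc b St <-> exists2 u, mset S u & u * (t * a) = u * (s * b).
Proof.
by split=> [/eqmodP/asboolP//|h]; apply/eqmodP/asboolP.
Qed.

Lemma mkloc_repr (x : loc) :
  mkloc (num (repr x)) (denP (repr x)) = x.
Proof.
rewrite -[RHS]reprK; apply/eqmodP/asboolP; exists 1 => //; exact: mset1.
Qed.

Lemma mklocP (x : loc) : exists a s (Ss : mset S s), x = mkloc a Ss.
Proof.
by exists (num (repr x)), (den (repr x)), (denP _); rewrite mkloc_repr.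
Qed.

Lemma repr_mkloc a s (Ss : mset S s) :
  exists2 u, mset S u & u * (s * num (repr (mkloc a Ss)))
                 = u * (den (repr (mkloc a Ss)) * a).
Proof. exact/(mkloc_eq _ (denP _))/mkloc_repr. Qed.

Definition loc_add (x y : loc) : loc :=
  let p := repr x in let q := repr y in
  mkloc (num p * den q + num q * den p) (msetM (denP p) (denP q)).
Definition loc_opp (x : loc) : loc :=
  let p := repr x in mkloc (- num p) (denP p).
Definition loc_mul (x y : loc) : loc :=
  let p := repr x in let q := repr y in
  mkloc (num p * num q) (msetM (denP p) (denP q)).

Lemma loc_addE a s (Ss : mset S s) b t (St : mset S t) :
  loc_add (mkloc a Ss) (mkloc b St) = mkloc (a * t + b * s) (msetM Ss St).
Proof.
rewrite /loc_add.
have [u Su] := repr_mkloc a Ss; have [v Sv] := repr_mkloc b St.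
move: (repr (mkloc b St)) (repr (mkloc a Ss)) => q p F E.
apply/mkloc_eq; exists (u * v); first exact: msetM.
transitivity (v * t * den q * (u * (s * num p))
              + u * s * den p * (v * (t * num q))); first by ring.
by rewrite E F; ring.
Qed.

Lemma loc_oppE a s (Ss : mset S s) : loc_opp (mkloc a Ss) = mkloc (- a) Ss.
Proof.
rewrite /loc_opp; have [u Su] := repr_mkloc a Ss.
move: (repr (mkloc a Ss)) => p E; apply/mkloc_eq; exists u => //.
by rewrite !mulrN E.
Qed.

Lemma loc_mulE a s (Ss : mset S s) b t (St : mset S t) :
  loc_mul (mkloc a Ss) (mkloc b St) = mkloc (a * b) (msetM Ss St).
Proof.
rewrite /loc_mul.
have [u Su] := repr_mkloc a Ss; have [v Sv] := repr_mkloc b St.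
move: (repr (mkloc b St)) (repr (mkloc a Ss)) => q p F E.
apply/mkloc_eq; exists (u * v); first exact: msetM.
transitivity ((u * (s * num p)) * (v * (t * num q))); first by ring.
by rewrite E F; ring.
Qed.

Let mkloc_eq1 a s (Ss : mset S s) b t (St : mset S t) :
  t * a = s * b -> mkloc a Ss = mkloc b St.
Proof. by move=> E; apply/mkloc_eq; exists 1; [exact: mset1|rewrite E]. Qed.

Lemma loc_addA : associative loc_add.
Proof.
move=> x y z; have [a [s [Ss ->]]] := mklocP x.
have [b [t [St ->]]] := mklocP y; have [c [r [Sr ->]]] := mklocP z.
by rewrite !loc_addE; apply: mkloc_eq1; ring.
Qed.

Lemma loc_addC : commutative loc_add.
Proof.
move=> x y; have [a [s [Ss ->]]] := mklocP x; have [b [t [St ->]]] := mklocP y.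
by rewrite !loc_addE; apply: mkloc_eq1; ring.
Qed.

Lemma loc_add0 : left_id (mkloc 0 (mset1 S)) loc_add.
Proof.
move=> x; have [a [s [Ss ->]]] := mklocP x.
by rewrite !loc_addE; apply: mkloc_eq1; ring.
Qed.

Lemma loc_addN : left_inverse (mkloc 0 (mset1 S)) loc_opp loc_add.
Proof.
move=> x; have [a [s [Ss ->]]] := mklocP x.
by rewrite loc_oppE !loc_addE; apply: mkloc_eq1; ring.
Qed.

HB.instance Definition _ :=
  GRing.isZmodule.Build loc loc_addA loc_addC loc_add0 loc_addN.

Lemma loc_mulA : associative loc_mul.
Proof.
move=> x y z; have [a [s [Ss ->]]] := mklocP x.
have [b [t [St ->]]] := mklocP y; have [c [r [Sr ->]]] := mklocP z.
by rewrite !loc_mulE; apply: mkloc_eq1; ring.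
Qed.

Lemma loc_mulC : commutative loc_mul.
Proof.
move=> x y; have [a [s [Ss ->]]] := mklocP x; have [b [t [St ->]]] := mklocP y.
by rewrite !loc_mulE; apply: mkloc_eq1; ring.
Qed.

Lemma loc_mul1 : left_id (mkloc 1 (mset1 S)) loc_mul.
Proof.
move=> x; have [a [s [Ss ->]]] := mklocP x.
by rewrite !loc_mulE; apply: mkloc_eq1; ring.
Qed.

Lemma loc_mulDl : left_distributive loc_mul loc_add.
Proof.
move=> x y z; have [a [s [Ss ->]]] := mklocP x.
have [b [t [St ->]]] := mklocP y; have [c [r [Sr ->]]] := mklocP z.
by rewrite !(loc_addE, loc_mulE); apply: mkloc_eq1; ring.
Qed.

HB.instance Definition _ :=
  GRing.Zmodule_isComPzRing.Build loc loc_mulA loc_mulC loc_mul1 loc_mulDl.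

Lemma mklocD a s (Ss : mset S s) b t (St : mset S t) :
  mkloc a Ss + mkloc b St = mkloc (a * t + b * s) (msetM Ss St).
Proof. exact: loc_addE. Qed.

Lemma mklocN a s (Ss : mset S s) : - mkloc a Ss = mkloc (- a) Ss.
Proof. exact: loc_oppE. Qed.

Lemma mklocM a s (Ss : mset S s) b t (St : mset S t) :
  mkloc a Ss * mkloc b St = mkloc (a * b) (msetM Ss St).
Proof. exact: loc_mulE. Qed.

Definition toloc (a : R) : loc := mkloc a (mset1 S).

Lemma toloc_is_zmod_morphism : zmod_morphism toloc.
Proof.
by move=> a b; rewrite mklocN mklocD; apply: mkloc_eq1; ring.
Qed.

Lemma toloc_is_monoid_morphism : monoid_morphism toloc.
Proof.
by split=> // a b; rewrite mklocM; apply: mkloc_eq1; ring.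
Qed.

HB.instance Definition _ :=
  GRing.isZmodMorphism.Build R loc toloc toloc_is_zmod_morphism.
HB.instance Definition _ :=
  GRing.isMonoidMorphism.Build R loc toloc toloc_is_monoid_morphism.

End Localization.

Section LocalizationMap.
Variables (R : comPzRingType) (S S' : mulset R) (SS' : S `<=` S').

Definition loc_map (x : loc S) : loc S' :=
  mkloc (sval (repr x)).1 (SS' (denP (repr x))).

Lemma loc_mapE a s (Ss : mset S s) : loc_map (mkloc a Ss) = mkloc a (SS' Ss).
Proof.
by apply/mkloc_eq; have [u /SS' S'u E] := repr_mkloc a Ss; exists u.
Qed.

Lemma loc_map_is_zmod_morphism : zmod_morphism loc_map.
Proof.
move=> x y; have [a [s [Ss ->]]] := mklocP x; have [b [t [St ->]]] := mklocP y.
rewrite mklocN mklocD !loc_mapE mklocN mklocD.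
by apply/mkloc_eq; exists 1; first exact: mset1.
Qed.

Lemma loc_map_is_monoid_morphism : monoid_morphism loc_map.
Proof.
split; first by rewrite loc_mapE; apply/mkloc_eq; exists 1; first exact: mset1.
move=> x y; have [a [s [Ss ->]]] := mklocP x; have [b [t [St ->]]] := mklocP y.
by rewrite mklocM !loc_mapE mklocM; apply/mkloc_eq; exists 1; first exact: mset1.
Qed.

HB.instance Definition _ :=
  GRing.isZmodMorphism.Build (loc S) (loc S') loc_map loc_map_is_zmod_morphism.
HB.instance Definition _ :=
  GRing.isMonoidMorphism.Build (loc S) (loc S') loc_map
    loc_map_is_monoid_morphism.

End LocalizationMap.

Section Localizations.
Variable R : comPzRingType.

Lemma reg1 : (~` Zdiv R) 1.
Proof. by case=> y /eqP y0; rewrite mul1r. Qed.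

Lemma regM x y : (~` Zdiv R) x -> (~` Zdiv R) y -> (~` Zdiv R) (x * y).
Proof.
move=> rx ry [z z0 E]; apply: rx; exists (y * z); last by rewrite mulrA.
by apply/eqP => yz0; apply: ry; exists z.
Qed.

Definition regset : mulset R := MulSet reg1 regM.

Definition totquot := loc regset.
HB.instance Definition _ := GRing.ComPzRing.on totquot.

Definition to_totquot : R -> totquot := toloc regset.
HB.instance Definition _ := GRing.RMorphism.on to_totquot.

Lemma primeC_M (P : set R) : is_prime P ->
  forall x y, (~` P) x -> (~` P) y -> (~` P) (x * y).
Proof. by move=> [_ _ PM] x y nx ny /PM[]. Qed.

Definition primeC (P : set R) (hP : is_prime P) : mulset R :=
  MulSet (let: And3 _ P1 _ := hP in P1) (primeC_M hP).

(* The extension [I R_S] of an ideal [I] of [R]. *)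
Definition ideal_ext (S : mulset R) (I : set R) : set (loc S) :=
  ideal_gen (toloc S @` I).
Arguments ideal_ext S I : clear implicits.

Definition locally_principal (I : set R) :=
  forall M (hM : is_maximal M),
    is_principal (ideal_ext (primeC (is_maximal_prime hM)) I).

Definition is_submod (M : set totquot) :=
  M 0 /\ forall a x y, M x -> M y -> M (to_totquot a * x + y).

(* Fractional ideals live in the total quotient ring, in which [R] is
   identified with its image [range to_totquot]. *)
Definition submod_mul (M N : set totquot) : set totquot :=
  smallest is_submod [set x * y | x in M & y in N].

Definition ideal_inv (I : set R) : set totquot :=
  [set x | forall a, I a -> range to_totquot (x * to_totquot a)].

Definition is_invertible (I : set R) :=
  submod_mul (to_totquot @` I) (ideal_inv I) = range to_totquot.

End Localizations.

Arguments totquot : clear implicits.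
Arguments to_totquot : clear implicits.
Arguments regset : clear implicits.

Section Image.
Variables (A B : comPzRingType) (f : {rmorphism A -> B}).

Definition in_rimage : {pred B} := fun y => y \in range f.

Lemma rimage_closed : subring_closed in_rimage.
Proof.
split.
- by apply/mem_set; exists 1; rewrite ?rmorph1.
- move=> _ _ /set_mem[x _ <-] /set_mem[y _ <-]; apply/mem_set.
  by exists (x - y); rewrite ?rmorphB.
- move=> _ _ /set_mem[x _ <-] /set_mem[y _ <-]; apply/mem_set.
  by exists (x * y); rewrite ?rmorphM.
Qed.

HB.instance Definition _ := GRing.isSubringClosed.Build B in_rimage rimage_closed.

Record rimage := RImage { rimage_val :> B; _ : rimage_val \in in_rimage }.

HB.instance Definition _ := [isSub for rimage_val].
HB.instance Definition _ := [Choice of rimage by <:].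
HB.instance Definition _ := 
  GRing.SubChoice_isSubComPzRing.Build B in_rimage rimage
    (GRing.subringClosedP _).

Lemma to_rimage_subproof x : f x \in in_rimage.
Proof. by apply/mem_set; exists x. Qed.

Definition to_rimage (x : A) : rimage := RImage (to_rimage_subproof x).

End Image.

Section PhiRing.
Variables (R : comPzRingType) (hR : is_phi_ring R).

Definition nilrad_prime : is_prime (nilrad R) := proj1 hR.

Lemma reg_sub_nilradC : regset R `<=` primeC nilrad_prime.
Proof.
move=> b rb [n bn0]; elim: n bn0 => [|n IHn].
  rewrite expr0 => R0; case: nilrad_prime => _ + _; apply.
  by exists 1%N; rewrite expr1.
rewrite exprS => E; have [/eqP/IHn//|bn0] := boolP (b ^+ n == 0).
by apply: rb; exists (b ^+ n).
Qed.

(* [phi (a / b) = a / b], by [loc_mapE]; [phi_res] is its restriction to [R]. *)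
Definition phi : totquot R -> loc (primeC nilrad_prime) :=
  loc_map reg_sub_nilradC.
HB.instance Definition _ := GRing.RMorphism.on phi.

Definition phi_res : R -> loc (primeC nilrad_prime) := phi \o to_totquot R.
HB.instance Definition _ := GRing.RMorphism.on phi_res.

Lemma phi_resE x : phi_res x = toloc (primeC nilrad_prime) x.
Proof.
by rewrite /phi_res /= /phi loc_mapE; apply/mkloc_eq; exists 1; first exact: mset1.
Qed.

Definition phiR := rimage phi_res.
HB.instance Definition _ := GRing.ComPzRing.on phiR.

Definition phi_ideal (I : set R) : set phiR := to_rimage phi_res @` I.

Definition is_phi_invertible (I : set R) := is_invertible (phi_ideal I).

Definition is_phi_Prufer :=
  forall I, is_ideal I -> is_fg I -> is_nonnil I -> is_phi_invertible I.

End PhiRing.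

Section Gaussian.
Variable R : comNzRingType.
Implicit Types f g : {poly R}.

Definition content f : set R := ideal_gen [set` (f : seq R)].

Definition is_gaussian f :=
  forall g, content (f * g) = ideal_mul (content f) (content g).

End Gaussian.

(* Main.v *)
Require Import Defs.
From HB Require Import structures.
From mathcomp Require Import all_boot all_algebra.
From mathcomp Require Import ring zify.
From mathcomp Require Import boolp classical_sets.

(** All four conditions revolve around one property of a nonnil finitely
    generated ideal [I]: at each maximal ideal [M] some [a] in [I] and some [u]
    outside [M] satisfy [u I <= a R] ([locally_dominated]).  This is local
    principality with the denominators cleared.  Two facts about a phi-ring make
    it accessible: a multiple of a non-nilpotent element that vanishes has a
    nilpotent cofactor, and every nilpotent element is a multiple of every
    non-nilpotent one.  Together they lift any relation that holds modulo the
    nilradical, or in [phi R], to one in [R], as long as a non-nilpotent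
    generator is there to absorb the error.

    If [phi I] is invertible and no [x a] with [a] in [phi I] and [x] in its
    inverse were the image of an element outside [M], the product of [phi I] and its inverse would lie
    in [phi M] ([phi_invertible_dominated]); from [x a = u] one gets
    [u b = a (x b)] for all [b] in [I].  Conversely, [u / a] lies in the inverse
    of [phi I], so the product of [phi I] and its inverse contains, for every [M],
    the image of an element outside [M], hence it contains [1] ([dominated_phi_invertible]).

    If [c(f)] is locally dominated, then locally [u f = a h], and some
    coefficient of [h] is outside [M]: otherwise [u a] would be in [a M], which
    forces [a], hence [c(f)], to be nilpotent.  A polynomial [h] with a
    coefficient outside [M] satisfies [v c(g) <= c(h g)] for some [v] outside
    [M] and every [g], nilpotent or not; this is Nakayama's lemma, carried out
    with the determinant of the triangular system that gives the coefficients of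
    [h g] modulo [M] ([content_mul_coef_notin]).  Hence [c(f) c(g) = c(f g)]
    ([locally_dominated_gaussian]).

    Suppose contents are multiplicative and [b] is not nilpotent.  The product
    [(a + b X) (a - b X)] gives [a b = x a^2 + y b^2].  Then [alpha = x a / b]
    is a root of [T^2 - T + x y], and comparing contents in
    [b^2 (T - alpha) (T - (1 - alpha))] shows that [x a] is a multiple of [b],
    say by [r].  So [r b] is in [a R] and [(1 - r) a] is in [b R]
    ([comparable_pair]).  As [r] or [1 - r] is outside [M], any two generators
    are comparable at [M], and an induction on the list of generators finds a
    dominating one ([dominating_generator]). *)

Set Implicit Arguments.
Unset Strict Implicit.
Unset Printing Implicit Defensive.

Import GRing.Theory.
Local Open Scope classical_set_scope.
Local Open Scope ring_scope.

(** * Ideals and the nilradical *)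

Section IdealCalculus.
Variable R : comPzRingType.
Implicit Types (I J M A : set R) (a b x y : R).

Lemma ideal0 I : is_ideal I -> I 0.
Proof. by case. Qed.

Lemma idealD I x y : is_ideal I -> I x -> I y -> I (x + y).
Proof. by move=> [_ ID] Ix Iy; rewrite -[x]mul1r; apply: ID. Qed.

Lemma idealMl I a x : is_ideal I -> I x -> I (a * x).
Proof. by move=> [I0 ID] Ix; rewrite -[_ * _]addr0; apply: ID. Qed.

Lemma idealMr I a x : is_ideal I -> I x -> I (x * a).
Proof. by rewrite mulrC; apply: idealMl. Qed.

Lemma idealB I x y : is_ideal I -> I x -> I y -> I (x - y).
Proof.
by move=> idI Ix Iy; apply: idealD => //; rewrite -mulN1r; apply: idealMl.
Qed.

Lemma ideal_sum I (T : Type) (r : seq T) (P : pred T) (F : T -> R) :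
  is_ideal I -> (forall i, P i -> I (F i)) -> I (\sum_(i <- r | P i) F i).
Proof.
by move=> idI IF; apply: big_ind => //; [exact: ideal0 | move=> *; exact: idealD].
Qed.

Lemma ideal_gen_ideal A : is_ideal (ideal_gen A).
Proof.
split=> [J [idJ _] | a x y Ax Ay J [idJ AJ]]; first exact: ideal0.
by case: (idJ) => _; apply; [apply: Ax | apply: Ay].
Qed.

Lemma sub_ideal_gen A : A `<=` ideal_gen A.
Proof. exact: sub_gen_smallest. Qed.

Lemma ideal_gen_sub A J : is_ideal J -> A `<=` J -> ideal_gen A `<=` J.
Proof. exact: smallest_sub. Qed.

Lemma multiples_ideal a : is_ideal [set x | exists z, x = a * z].
Proof.
split=> [|c _ _ [y ->] [z ->]]; first by exists 0; rewrite mulr0.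
by exists (c * y + z); ring.
Qed.

Lemma ideal_gen1 a x : ideal_gen [set a] x -> exists z, x = a * z.
Proof.
move: x; suff : ideal_gen [set a] `<=` [set x | exists z, x = a * z] by [].
by apply: (ideal_gen_sub (multiples_ideal a)) => _ ->; exists 1; rewrite mulr1.
Qed.

End IdealCalculus.

(** * Maximal ideals and local principality *)

Section Domination.
Variable R : comPzRingType.
Implicit Types (I M : set R) (a b : R).

Lemma exists_maximal I :
  is_ideal I -> ~ I 1 -> exists2 M, is_maximal M & I `<=` M.
Proof.
move=> idI I1.
(* Adjoining [I] to [A] makes the condition hold for the union of the empty
   chain, which Zorn's lemma requires. *)
pose P := [set A : set R | is_ideal (A `|` I) /\ ~ (A `|` I) 1].
have [F FP Ftot|A [[idA A1] Amax]] := @Zorn_bigcup R P.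
  split; last first.
    case=> [[A FA A1]|//]; case: (FP _ FA) => _; apply; by left.
  split; first by right; exact: ideal0.
  move=> a x y [[A FA Ax]|Ix] [[B FB By]|Iy].
  - have [AB|BA] := Ftot _ _ FA FB.
    + have [[_ +] _] := FP _ FB => /(_ a x y (or_introl (AB _ Ax)) (or_introl By)).
      by case=> [?|?]; [left; exists B | right].
    + have [[_ +] _] := FP _ FA => /(_ a x y (or_introl Ax) (or_introl (BA _ By))).
      by case=> [?|?]; [left; exists A | right].
  - have [[_ +] _] := FP _ FA => /(_ a x y (or_introl Ax) (or_intror Iy)).
    by case=> [?|?]; [left; exists A | right].
  - have [[_ +] _] := FP _ FB => /(_ a x y (or_intror Ix) (or_introl By)).
    by case=> [?|?]; [left; exists B | right].
  - by right; case: idI => _; apply.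
exists (A `|` I); last by move=> x; right.
split=> // J idJ AJ; have [J1|J1] := pselect (J 1).
  by right; rewrite -subTset => x _; rewrite -[x]mulr1; apply: idealMl.
left; apply/seteqP; split=> // x Jx; left; apply: contrapT => nAx.
have JI : J `|` I = J.
  by apply/seteqP; split=> [y [//|Iy]|y]; [apply: AJ; right | left].
apply: (Amax J); last by split; rewrite JI.
by split=> [y Ay|/(_ x Jx)//]; apply: AJ; left.
Qed.

(** The local-global principle: an equality or membership is checked by applying
    this to the ideal of the multipliers for which it holds. *)
Lemma ideal_local_one K :
  is_ideal K -> (forall M, is_maximal M -> exists2 v, ~ M v & K v) -> K 1.
Proof.
move=> idK loc; apply: contrapT => K1.
have [M maxM KM] := exists_maximal idK K1.
by have [v Mv /KM] := loc M maxM.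
Qed.

Lemma nilrad_ideal : is_ideal (nilrad R).
Proof.
split=> [|a x y [m xm0] [n yn0]]; first by exists 1%N; rewrite expr1.
exists (m + n)%N; rewrite exprDn big1 // => i _.
have [le_n_i|lt_i_n] := leqP n i.
  by rewrite -(subnK le_n_i) [y ^+ _]exprD yn0 !mulr0 mul0rn.
have -> : (m + n - i = m + (n - i))%N by lia.
by rewrite exprMn [x ^+ _]exprD xm0 mul0r mulr0 mul0r mul0rn.
Qed.

Lemma prime_notinM {P : set R} {x y} :
  is_prime P -> ~ P x -> ~ P y -> ~ P (x * y).
Proof. by move=> [_ _ PM] nx ny /PM[]. Qed.

Lemma prime_expr (P : set R) x n : is_prime P -> P (x ^+ n) -> P x.
Proof.
move=> primeP; have [_ P1 PM] := primeP.
by elim: n => [|n IHn]; rewrite ?expr0 // exprS => /PM[].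
Qed.

Lemma nilrad_sub_prime (P : set R) : is_prime P -> nilrad R `<=` P.
Proof.
move=> primeP x [n xn0]; apply: (@prime_expr _ x n) => //; rewrite xn0.
by apply: ideal0; case: primeP.
Qed.

(** Asking for one [u] for all [b] avoids fractions; for a finitely generated
    ideal it is no stronger than a separate [u] for each [b]. *)
Definition locally_dominated I :=
  forall M, is_maximal M ->
    exists a u, [/\ I a, ~ M u & forall b, I b -> exists z, u * b = a * z].

Lemma ideal_ext_frac (S : mulset R) I (x : loc S) :
  is_ideal I -> ideal_ext I x -> exists b s (Ss : mset S s), I b /\ x = mkloc b Ss.
Proof.
move=> idI; move: x.
suff : ideal_ext I `<=` [set x | exists b s (Ss : mset S s), I b /\ x = mkloc b Ss].
  by [].
apply: ideal_gen_sub.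
  split; first by exists 0, 1, (mset1 S); split=> //; exact: ideal0.
  move=> c _ _ [b [s [Ss [Ib ->]]]] [d [t [St [Id ->]]]].
  have [e [r [Sr ->]]] := mklocP c.
  rewrite mklocM mklocD; do 3 eexists; split; last reflexivity.
  by apply: idealD => //; apply: idealMr => //; apply: idealMl.
by move=> _ [b Ib <-]; exists b, 1, (mset1 S).
Qed.

(** The product of the multipliers of the finitely many generators serves them
    all, and [M] is prime. *)
Lemma fg_uniform_denominator M a (s : seq R) :
  is_prime M ->
  (forall b, b \in s -> exists2 u, ~ M u & exists z, u * b = a * z) ->
  exists2 u, ~ M u & forall b, ideal_gen [set` s] b -> exists z, u * b = a * z.
Proof.
move=> primeM locs.
suff [u Mu us] : exists2 u, ~ M u & forall b, b \in s -> exists z, u * b = a * z.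
  exists u => //.
  suff : ideal_gen [set` s] `<=` [set b | exists z, u * b = a * z] by [].
  apply: ideal_gen_sub; last exact: us.
  split=> [|c x y [z zE] [t tE]]; first by exists 0; rewrite !mulr0.
  exists (c * z + t); transitivity (c * (u * x) + u * y); first by ring.
  by rewrite zE tE; ring.
elim: s locs => [|c s IHs] locs; first by exists 1 => //; case: primeM.
have [b bs|u Mu us] := IHs; first by apply: locs; rewrite in_cons bs orbT.
have [v Mv [z zE]] := locs c (mem_head _ _).
exists (u * v); first exact: (prime_notinM primeM).
move=> b; rewrite in_cons => /predU1P[->|/us[t tE]].
  by exists (u * z); rewrite -mulrA zE; ring.
by exists (v * t); rewrite [u * v]mulrC -mulrA tE; ring.
Qed.

(** Up to a unit of the localization, the given generator of the extension is the
    image of an element of [I], so it can be taken as the dominating element. *)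
Lemma locally_principal_dominated I :
  is_ideal I -> is_fg I -> locally_principal I -> locally_dominated I.
Proof.
move=> idI [s sE] locI M maxM; have [x extE] := locI M maxM.
have : @ideal_ext _ (primeC (is_maximal_prime maxM)) I x.
  by rewrite extE; apply: sub_ideal_gen.
case/(ideal_ext_frac idI)=> a [t [St [Ia xE]]]; exists a.
have [b bs|u Mu us] := @fg_uniform_denominator M a s (is_maximal_prime maxM).
  have : ideal_gen [set x] (toloc (primeC (is_maximal_prime maxM)) b).
    rewrite -extE; apply: sub_ideal_gen; exists b => //.
    by rewrite sE; apply: sub_ideal_gen.
  case/ideal_gen1=> y; have [c [r [Sr ->]]] := mklocP y.
  rewrite xE mklocM => /mkloc_eq[v Sv vE].
  exists (v * (t * r)); first exact: (msetM Sv (msetM St Sr)).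
  by exists (v * c); rewrite -mulrA vE; ring.
by exists u; split=> //; rewrite sE.
Qed.

Lemma dominated_locally_principal I :
  locally_dominated I -> locally_principal I.
Proof.
move=> domI M maxM; have [a [u [Ia Mu uI]]] := domI M maxM.
set S := primeC _; exists (toloc S a); apply/seteqP; split; last first.
  apply: ideal_gen_sub; first exact: ideal_gen_ideal.
  by move=> _ ->; apply: sub_ideal_gen; exists a.
apply: ideal_gen_sub; first exact: ideal_gen_ideal.
move=> _ [b /uI[z zE] <-].
have -> : toloc S b = @mkloc _ S z u Mu * toloc S a.
  rewrite mklocM; apply/mkloc_eq; exists 1; first exact: mset1.
  by rewrite mulr1 zE; ring.
by apply: (idealMl _ (ideal_gen_ideal _)); exact: sub_ideal_gen.
Qed.

End Domination.

(** * Contents of polynomials *)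

Section Content.
Variable R : comNzRingType.
Implicit Types (I J P : set R) (f g h : {poly R}) (a b : R).

Lemma content_coef f i : content f f`_i.
Proof.
have [lt_i_f|le_f_i] := ltnP i (size f).
  by apply: sub_ideal_gen => /=; exact: mem_nth.
by rewrite nth_default //; exact: ideal0 (ideal_gen_ideal _).
Qed.

Lemma content_sub f J : is_ideal J -> (forall i, J f`_i) -> content f `<=` J.
Proof.
move=> idJ Jf; apply: ideal_gen_sub => // x /= xf.
by rewrite -(nth_index 0 xf).
Qed.

Lemma ideal_mulP I J K : is_ideal K ->
  (forall x y, I x -> J y -> K (x * y)) -> ideal_mul I J `<=` K.
Proof.
by move=> idK IJK; apply: ideal_gen_sub => // _ [x Ix [y Jy <-]]; exact: IJK.
Qed.

Lemma ideal_mul_mem I J x y : I x -> J y -> ideal_mul I J (x * y).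
Proof. by move=> Ix Jy; apply: sub_ideal_gen; exists x => //; exists y. Qed.

Lemma content_mul_sub f g : content (f * g) `<=` ideal_mul (content f) (content g).
Proof.
apply: content_sub; first exact: ideal_gen_ideal.
move=> i; rewrite coefM; apply: ideal_sum; first exact: ideal_gen_ideal.
by move=> j _; apply: ideal_mul_mem; exact: content_coef.
Qed.

Lemma prime_prod_notin P (n : nat) (F : 'I_n -> R) :
  is_prime P -> (forall i, ~ P (F i)) -> ~ P (\prod_i F i).
Proof.
move=> primeP PF; apply: (big_ind (fun x => ~ P x)) => //; first by case: primeP.
by move=> x y; exact: prime_notinM.
Qed.

(** Replacing the entries above the diagonal by zero changes each term of the
    Leibniz formula by an element of [P]. *)
Lemma det_lower_mod P (n : nat) (A : 'M[R]_n) :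
  is_ideal P -> (forall i j : 'I_n, (i < j)%N -> P (A i j)) ->
  P (\det A - \prod_i A i i).
Proof.
move=> idP PA; pose B := \matrix_(i, j) if (i < j)%N then 0 else A i j.
have <- : \det B = \prod_i A i i.
  rewrite det_trig; first by apply: eq_bigr => i _; rewrite mxE ltnn.
  by apply/is_trig_mxP => i j ltij; rewrite mxE ltij.
rewrite -sumrB; apply: ideal_sum => // s _; rewrite -mulrBr; apply: idealMl => //.
elim/big_rec2: _ => [|i y x _ IH]; first by rewrite subrr; exact: ideal0.
rewrite [B _ _]mxE; case: ifP => [lti|_].
  rewrite mul0r subr0; apply: idealMr => //; exact: PA.
by rewrite -mulrBr; apply: idealMl.
Qed.

(** Locally at [P], a polynomial with a unit coefficient does not shrink contents.
    When [h`_k] is the first coefficient outside [P], the equations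
    [(h g)`_(k + j) = sum_l h`_(k + j - l) g`_l] form a square system in the
    coefficients of [g] that is lower triangular modulo [P] with [h`_k] on the
    diagonal.  Multiplying by the adjugate matrix puts [det A * g`_j] in
    [c(h g)], and [det A] is congruent to a power of [h`_k]. *)
Lemma content_mul_coef_notin P h g k :
  is_prime P -> ~ P h`_k ->
  exists2 v, ~ P v & forall j, content (h * g) (v * g`_j).
Proof.
move=> primeP.
have [idP P1 PM] := primeP.
suff main m : ~ P h`_m -> (forall i, (i < m)%N -> P h`_i) ->
    exists2 v, ~ P v & forall j, content (h * g) (v * g`_j).
  elim/ltn_ind: k => k IHk Phk.
  have [[i [ltik Phi]]|noi] := pselect (exists i, (i < k)%N /\ ~ P h`_i).
    exact: IHk Phi.
  by apply: (main k) => // i ltik; apply: contrapT => Phi; apply: noi; exists i.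
move=> Phm minm; set n := size g.
pose A := \matrix_(j < n, l < n) if (l <= m + j)%N then h`_(m + j - l) else 0.
pose w := \col_(j < n) g`_j.
have AwE (j : 'I_n) : (A *m w) j 0 = (h * g)`_(m + j).
  rewrite mxE coefMr.
  under eq_bigr do rewrite !mxE.
  (* Both sums extend by zeros to a common range. *)
  transitivity (\sum_(0 <= l < n) (if (l <= m + j)%N then h`_(m + j - l) else 0) * g`_l).
    by rewrite big_mkord.
  transitivity (\sum_(0 <= l < maxn n (m + j).+1)
      (if (l <= m + j)%N then h`_(m + j - l) else 0) * g`_l).
    rewrite [RHS](big_cat_nat (n := n)) ?leq_maxl //= [X in _ + X]big1_seq ?addr0 //.
    by move=> l /andP[_]; rewrite mem_index_iota => /andP[len _]; rewrite [g`_l]nth_default ?mulr0.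
  rewrite (big_cat_nat (n := (m + j).+1)) ?leq_maxr //= [X in _ + X]big1_seq ?addr0.
    by rewrite big_mkord; apply: eq_bigr => l _; rewrite -ltnS ltn_ord.
  move=> l /andP[_]; rewrite mem_index_iota => /andP[ltl _].
  by rewrite leqNgt ltl mul0r.
exists (\det A).
  have Pdiff : P (\det A - \prod_i A i i).
    apply: det_lower_mod => // i j ltij; rewrite mxE; case: ifP => [lej|_].
      apply: minm; lia.
    exact: ideal0.
  move=> PdetA; apply: (@prime_prod_notin P n (fun i => A i i)) => //.
    by move=> i; rewrite mxE leq_addl addnK.
  by rewrite -[X in P X](subKr (\det A)); exact: idealB.
move=> j; have idC := ideal_gen_ideal [set` (h * g : seq R)].
have [ltj|lej] := ltnP j n; last by rewrite nth_default // mulr0; exact: ideal0.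
have -> : \det A * g`_j = (\adj A *m (A *m w)) (Ordinal ltj) 0.
  by rewrite mulmxA mul_adj_mx mul_scalar_mx !mxE.
rewrite mxE; apply: (ideal_sum _ idC) => l _; apply: (idealMl _ idC).
by rewrite AwE; exact: content_coef.
Qed.

Lemma nilpotent_of_coefs f : content f `<=` nilrad R -> nilrad {poly R} f.
Proof.
move=> nilf; rewrite -[f]coefK poly_def.
apply: ideal_sum => [|i _]; first exact: nilrad_ideal.
rewrite -mul_polyC; apply: idealMr; first exact: nilrad_ideal.
have [n fn0] := nilf _ (content_coef i).
by exists n; rewrite -polyC_exp fn0.
Qed.

Lemma lead_coef_nonnil f : ~ nilrad R (lead_coef f) -> ~ nilrad {poly R} f.
Proof.
move=> nnil [n fn0].
have lcX m : lead_coef (f ^+ m) = lead_coef f ^+ m.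
  elim: m => [|m IHm]; first by rewrite !expr0 lead_coef1.
  rewrite exprS lead_coef_proper_mul IHm -exprS //.
  by apply/eqP => lc0; apply: nnil; exists m.+1.
by apply: nnil; exists n; rewrite -lcX fn0 lead_coef0.
Qed.

(** At a maximal ideal, [u f = a h] where [h] has a coefficient outside it, and
    then [c(f) c(g) = a c(h) c(g) <= a c(g) = a c(h g) = c(f g)] up to factors
    that are units there. *)
Lemma locally_dominated_gaussian f g :
  is_prime (nilrad R) -> ~ content f `<=` nilrad R ->
  locally_dominated (content f) ->
  content (f * g) = ideal_mul (content f) (content g).
Proof.
move=> primeN nnil domf; apply/seteqP; split; first exact: content_mul_sub.
have idC := ideal_gen_ideal [set` (f * g : seq R)].
pose K := [set v | forall i j, content (f * g) (v * (f`_i * g`_j))].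
have idK : is_ideal K.
  split=> [i j|a x y Kx Ky i j]; first by rewrite mul0r; exact: ideal0.
  by rewrite mulrDl -mulrA; case: (idC) => _; apply; [apply: Kx | apply: Ky].
suff K1 : K 1.
  have cfg i j : content (f * g) (f`_i * g`_j) by move: (K1 i j); rewrite mul1r.
  apply: ideal_mulP => // x y cx cy.
  have colon_ideal z : is_ideal [set x | content (f * g) (x * z)].
    split=> [|a b c /= bz cz]; first by rewrite /= mul0r; exact: ideal0.
    by rewrite mulrDl -mulrA; case: (idC) => _; apply.
  suff cgx : content g `<=` [set y | content (f * g) (y * x)].
    by rewrite [x * y]mulrC; exact: (cgx _ cy).
  apply: content_sub => // j /=; rewrite [g`_j * x]mulrC.
  suff fsub : content f `<=` [set x | content (f * g) (x * g`_j)] by exact: (fsub _ cx).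
  by apply: content_sub => // i; exact: cfg.
apply: ideal_local_one => // M maxM.
have primeM := is_maximal_prime maxM; have [idM M1 _] := primeM.
have [a [u [fa Mu ufa]]] := domf M maxM.
have /choice[c cE] : forall i, exists z, u * f`_i = a * z.
  by move=> i; apply: ufa; exact: content_coef.
pose h := \poly_(i < size f) c i.
have hE i : u * f`_i = a * h`_i.
  rewrite coef_poly; case: ltnP => // le_f_i.
  by rewrite nth_default // !mulr0.
have uf_ah : u *: f = a *: h by apply/polyP => i; rewrite !coefZ hE.
(* If [c(h)] were inside [M], then [u b] would be in [a M] for all [b] in
   [c(f)], in particular for [b = a]: so [(u - m) a = 0] with [u - m] outside
   [M], and [a], then all of [c(f)], would be nilpotent. *)
have [k Mhk] : exists k, ~ M h`_k.
  apply: contrapT => noh.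
  have Mh i : M h`_i by apply: contrapT => ?; apply: noh; exists i.
  have /(_ a fa)[m Mm uaE] : content f `<=` [set b | exists2 m, M m & u * b = a * m].
    apply: content_sub => [|i]; last by exists h`_i.
    split=> [|d x y [m Mm mE] [n Mn nE]].
      by exists 0; [exact: ideal0 | rewrite !mulr0].
    exists (d * m + n); first by case: idM => _; apply.
    transitivity (d * (u * x) + u * y); first by ring.
    by rewrite mE nE; ring.
  have [idN N1 NM] := primeN.
  have Num : ~ nilrad R (u - m).
    move=> /(nilrad_sub_prime primeM) Mum; apply: Mu.
    by rewrite -(subrK m u); exact: idealD.
  have [|//|Na] := NM (u - m) a.
    by rewrite mulrBl uaE mulrC subrr; exact: ideal0.
  apply: nnil => x fx; have [z ux] := ufa x fx.
  have [|Nu|//] := NM u x; first by rewrite ux; exact: idealMr.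
  by case: Mu; exact: (nilrad_sub_prime primeM).
have [v Mv vg] := content_mul_coef_notin g primeM Mhk.
exists (u * v); first exact: (prime_notinM primeM).
move=> i j.
have -> : u * v * (f`_i * g`_j) = h`_i * (a * (v * g`_j)).
  by transitivity (u * f`_i * (v * g`_j)); [|rewrite hE]; ring.
apply: (idealMl _ idC).
have: [set y | content (f * g) (y * a)] (v * g`_j); last by rewrite /= [a * _]mulrC.
apply: (_ : content (h * g) `<=` _) (vg j).
apply: content_sub => [|l /=].
  split=> [|d x y /= xz yz]; first by rewrite /= mul0r; exact: ideal0.
  by rewrite mulrDl -mulrA; case: (idC) => _; apply.
rewrite [_ * a]mulrC -coefZ scalerAl -uf_ah -scalerAl coefZ.
by apply: (idealMl _ idC); exact: content_coef.
Qed.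

End Content.

(** * Divided prime nilradicals *)

Section DividedNilradical.
Variables (R : comPzRingType) (hR : is_phi_ring R).
Implicit Types (a b x y : R) (I M : set R).

Local Notation N := (nilrad R).

(** The principal ideal of [b] is comparable with the nilradical and not contained
    in it. *)
Lemma nilrad_divisible b : ~ N b -> forall n, N n -> exists z, n = b * z.
Proof.
move=> Nb n Nn; case: hR => _ /(_ _ (multiples_ideal b))[/(_ n Nn)//|bN].
by case: Nb; apply: bN; exists 1; rewrite mulr1.
Qed.

Lemma nonnil_cancel b x : ~ N b -> b * x = 0 -> N x.
Proof.
move=> Nb bx0; have [[N0 _] _ NM] := nilrad_prime hR.
by have [|//|] := NM b x; rewrite ?bx0.
Qed.

End DividedNilradical.

(** * Multiplicativity of contents and comparability of generators *)

Section GaussianPairs.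
Variables (R : comNzRingType) (hR : is_phi_ring R).
Implicit Types (a b x y : R) (M : set R).

Local Notation N := (nilrad R).

Definition linpoly a b : {poly R} := a%:P + b%:P * 'X.

Lemma linpoly_nonnil a b : ~ N b -> ~ nilrad {poly R} (linpoly a b).
Proof.
move=> Nb; apply: lead_coef_nonnil.
have b0 : b != 0 by apply/eqP => b0; apply: Nb; rewrite b0; exists 1%N; rewrite expr1.
rewrite lead_coefDr ?lead_coefMX ?lead_coefC //.
by rewrite size_mulX ?polyC_eq0 // !size_polyC b0; case: (a != 0).
Qed.

Lemma linpolyM a b c d :
  linpoly a b * linpoly c d = (a * c)%:P + (a * d + b * c)%:P * 'X + (b * d)%:P * 'X^2.
Proof. rewrite /linpoly; ring. Qed.

Lemma coef_linpolyM a b c d (J : set R) : is_ideal J ->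
  J (a * c) -> J (a * d + b * c) -> J (b * d) ->
  content (linpoly a b * linpoly c d) `<=` J.
Proof.
move=> idJ J0 J1 J2; apply: content_sub => // i.
rewrite linpolyM !coefD !coefCM coefC coefX coefXn.
have JMn e (n : bool) : J e -> J (e * n%:R) by exact: (idealMr _ idJ).
apply: (idealD idJ); last exact: JMn.
apply: (idealD idJ); last exact: JMn.
by case: ifP => // _; exact: ideal0.
Qed.

Lemma content_linpoly a b : content (linpoly a b) a /\ content (linpoly a b) b.
Proof.
have := @content_coef R (linpoly a b) 0; have := @content_coef R (linpoly a b) 1.
by rewrite !coefD !coefCM !coefC !coefX /= mulr0 mulr1 addr0 add0r.
Qed.

Lemma nonnilN b : ~ N b -> ~ N (- b).
Proof.
move=> Nb Nnb; apply: Nb; rewrite -[b]opprK -mulN1r.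
by apply: idealMl => //; exact: nilrad_ideal.
Qed.

Hypothesis content_mul : forall f g : {poly R},
  ~ nilrad {poly R} f -> ~ nilrad {poly R} g ->
  content (f * g) = ideal_mul (content f) (content g).

(** In the localization at any prime, one of [a] and [b] divides the other, since
    [r] or [1 - r] is a unit.  The two identities in the proof hold in the
    fraction field of the quotient by the nilradical with [r = x a / b]; each
    lifts to [R] at the cost of a nilpotent error, which is a multiple of [b]. *)
Lemma comparable_pair a b : ~ N b ->
  exists r, (exists z, r * b = a * z) /\ (exists z, (1 - r) * a = b * z).
Proof.
move=> Nb; have NNb := nonnilN Nb.
have [x [y abE]] : exists x y, a * b = x * a ^+ 2 + y * b ^+ 2.
  pose J := [set z | exists x y, z = x * a ^+ 2 + y * b ^+ 2].
  have idJ : is_ideal J.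
    split=> [|c _ _ [x [y ->]] [x' [y' ->]]]; first by exists 0, 0; ring.
    by exists (c * x + x'), (c * y + y'); ring.
  have cJ : content (linpoly a b * linpoly a (- b)) `<=` J.
    apply: coef_linpolyM => //; [exists 1, 0 | exists 0, 0 | exists 0, (- 1)]; ring.
  have /cJ[x [y xyE]] : content (linpoly a b * linpoly a (- b)) (a * - b).
    rewrite content_mul; try exact: linpoly_nonnil.
    by apply: ideal_mul_mem; [case: (content_linpoly a b) | case: (content_linpoly a (- b))].
  by exists (- x), (- y); rewrite -[LHS]opprK -mulrN xyE; ring.
(* The second polynomials are [b (T - alpha)] and [b (T - (1 - alpha))] for
   [alpha = x a / b]; their product is [b^2 (T^2 - T + x y)]. *)
have [r bxaE] : exists r, b * (x * a) = b * (b * r).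
  have cJ : content (linpoly (- (x * a)) b * linpoly (x * a - b) b)
            `<=` [set z | exists r, z = b ^+ 2 * r].
    apply: coef_linpolyM; first exact: multiples_ideal.
    - exists (x * y); transitivity (x * (a * b - x * a ^+ 2)); first by ring.
      by rewrite abE; ring.
    - by exists (- 1); ring.
    - by exists 1; ring.
  have /cJ[r rE] : content (linpoly (- (x * a)) b * linpoly (x * a - b) b)
                     (- (x * a) * b).
    rewrite content_mul; try exact: linpoly_nonnil.
    apply: ideal_mul_mem; first by case: (content_linpoly (- (x * a)) b).
    by case: (content_linpoly (x * a - b) b).
  exists (- r); transitivity (- (- (x * a) * b)); first by ring.
  by rewrite rE; ring.
have [n nE] : exists n, x * a - b * r = b * n.
  apply: (nilrad_divisible hR) => //; apply: (nonnil_cancel hR Nb).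
  by rewrite mulrBr bxaE subrr.
have xaE : x * a = b * (r + n) by rewrite mulrDr -nE; ring.
exists (r + n); split; first by exists x; rewrite mulrC -xaE mulrC.
have [m mE] : exists m, (1 - (r + n)) * a - y * b = b * m.
  apply: (nilrad_divisible hR) => //; apply: (nonnil_cancel hR Nb).
  transitivity (a * b - b * (r + n) * a - y * b ^+ 2); first by ring.
  by rewrite -xaE abE; ring.
by exists (y + m); rewrite mulrDr -mE; ring.
Qed.

(** The dominating generator is kept non-nilpotent, so that it can be compared
    with the next one; while all generators met are nilpotent, the first
    non-nilpotent one divides them all. *)
Lemma dominating_generator M (s : seq R) : is_prime M ->
  (exists2 b, b \in s & ~ N b) ->
  exists a u, [/\ a \in s, ~ N a, ~ M u
                & forall b, b \in s -> exists z, u * b = a * z].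
Proof.
move=> primeM; have [idM M1 _] := primeM; have [_ _ NM] := nilrad_prime hR.
elim: s => [[]//|c s IHs nns].
have [[b bs Nb]|nils] := pselect (exists2 b, b \in s & ~ N b); last first.
  have Ns b : b \in s -> N b by move=> bs; apply: contrapT => Nb; apply: nils; exists b.
  have Nc : ~ N c by case: nns => b; rewrite in_cons => /predU1P[->//|/Ns].
  exists c, 1; split; rewrite ?mem_head // => b; rewrite in_cons mul1r.
  by case/predU1P=> [->|/Ns/(nilrad_divisible hR Nc)//]; exists 1; rewrite mulr1.
have [|a [u [as_ Na Mu us]]] := IHs; first by exists b.
have [r [[z zE] [t tE]]] := comparable_pair c Na.
have [Mr|Mr] := pselect (M r).
  have Mr' : ~ M (1 - r) by move=> /(idealD idM Mr); rewrite addrC subrK.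
  exists a, ((1 - r) * u); split=> //; first by rewrite in_cons as_ orbT.
    exact: (prime_notinM primeM).
  move=> d; rewrite in_cons => /predU1P[->|/us[w wE]].
    by exists (u * t); rewrite mulrAC tE; ring.
  by exists ((1 - r) * w); rewrite -mulrA wE; ring.
exists c, (r * u); split; first exact: mem_head.
- move=> Nc; have [|Nr|//] := NM r a; last first.
    by apply: Mr; exact: (nilrad_sub_prime primeM).
  by rewrite zE; apply: idealMr => //; exact: nilrad_ideal.
- exact: (prime_notinM primeM).
move=> d; rewrite in_cons => /predU1P[->|/us[w wE]].
  by exists (r * u); ring.
by exists (z * w); rewrite -mulrA wE mulrA zE; ring.
Qed.

End GaussianPairs.

(** * Invertibility in the image of phi *)

Section Phi.
Variables (R : comPzRingType) (hR : is_phi_ring R).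
Local Notation ph := (to_rimage (phi_res hR)).
Local Notation tq := (to_totquot (phiR hR)).

Lemma to_rimage_is_zmod_morphism : zmod_morphism ph.
Proof. by move=> a b; apply: val_inj; rewrite /= rmorphB. Qed.

Lemma to_rimage_is_monoid_morphism : monoid_morphism ph.
Proof. by split=> [|a b]; apply: val_inj; rewrite /= ?rmorph1 ?rmorphM. Qed.

HB.instance Definition _ :=
  GRing.isZmodMorphism.Build R (phiR hR) ph to_rimage_is_zmod_morphism.
HB.instance Definition _ :=
  GRing.isMonoidMorphism.Build R (phiR hR) ph to_rimage_is_monoid_morphism.

Lemma to_rimage_surj (y : phiR hR) : exists x, y = ph x.
Proof.
case: y => y yP; have [x _ xE] := set_mem yP.
by exists x; apply: val_inj.
Qed.

Lemma to_rimage_eq x y : ph x = ph y <-> exists2 u, ~ nilrad R u & u * x = u * y.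
Proof.
have -> : (ph x = ph y) <-> (phi_res hR x = phi_res hR y).
  by split=> [/(congr1 val)|xy]; [| exact: val_inj].
rewrite !phi_resE; split=> [/mkloc_eq[u Nu]|[u Nu uE]]; rewrite ?mul1r.
  by exists u.
by apply/mkloc_eq; exists u; rewrite ?mul1r.
Qed.

Lemma to_totquot_inj (A : comPzRingType) : injective (to_totquot A).
Proof.
move=> x y /mkloc_eq[u ru]; rewrite !mul1r => /eqP; rewrite -subr_eq0 -mulrBr => /eqP uxy.
apply/eqP; rewrite -subr_eq0; apply/negP => /negP xy.
by apply: ru; exists (x - y).
Qed.

(** A non-nilpotent element becomes a unit in the localization at the nilradical. *)
Lemma to_rimage_regular a : ~ nilrad R a -> mset (regset (phiR hR)) (ph a).
Proof.
move=> Na [y y0 ay0]; have [c yE] := to_rimage_surj y.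
move: ay0; rewrite yE -rmorphM -(rmorph0 ph) => /to_rimage_eq[u Nu uE].
move/eqP: y0; apply; rewrite yE -(rmorph0 ph); apply/to_rimage_eq.
exists (u * a); first exact: (prime_notinM (nilrad_prime hR)).
by rewrite -mulrA uE !mulr0.
Qed.

Lemma to_rimage_eq_nil x y : ph x = ph y -> nilrad R (x - y).
Proof.
case/to_rimage_eq=> u Nu uE; apply: (nonnil_cancel hR Nu).
by rewrite mulrBr uE subrr.
Qed.

(** Some product [x a] with [a] in [phi I] and [x] in its inverse is the image of
    an element outside [M]: otherwise the image of [M] would contain the whole
    product, hence [1]. *)
Lemma phi_invertible_dominated (I : set R) :
  is_ideal I -> is_nonnil I -> is_phi_invertible hR I -> locally_dominated I.
Proof.
move=> idI nnI invI M maxM; have primeM := is_maximal_prime maxM.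
have [idM M1 _] := primeM; have [[N0 _] _ NM] := nilrad_prime hR.
have [a [x [u [Ia invx Mu xa]]]] : exists a x u,
    [/\ I a, ideal_inv (@phi_ideal R hR I) x, ~ M u & x * tq (ph a) = tq (ph u)].
  apply: contrapT => none.
  have sub : submod_mul (tq @` @phi_ideal R hR I) (ideal_inv (@phi_ideal R hR I))
             `<=` (tq \o ph) @` M.
    apply: smallest_sub.
      split=> [|c _ _ [m Mm <-] [n Mn <-]].
        by exists 0; [exact: ideal0 | rewrite /= !rmorph0].
      have [d ->] := to_rimage_surj c.
      exists (d * m + n); first by case: idM => _; apply.
      by rewrite /= !(rmorphD, rmorphM).
    move=> _ [_ [_ [a Ia <-] <-] [x invx <-]].
    have [c _ cE] := invx (ph a) (ex_intro2 _ _ a Ia erefl).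
    have [u uE] := to_rimage_surj c.
    exists u; last by rewrite /= -uE cE mulrC.
    apply: contrapT => Mu; apply: none; exists a, x, u; split=> //.
    by rewrite -uE.
  have : range tq (tq 1) by exists 1.
  rewrite -[range _]invI => /sub[m Mm /to_totquot_inj].
  rewrite -(rmorph1 ph) => /to_rimage_eq_nil/(nilrad_sub_prime primeM) Mm1.
  by apply: M1; rewrite -(subKr m 1); apply: idealB.
have uab b : I b -> exists r, nilrad R (u * b - a * r).
  move=> Ib; have [c _ cE] := invx (ph b) (ex_intro2 _ _ b Ib erefl).
  have [r rE] := to_rimage_surj c; exists r.
  apply: to_rimage_eq_nil; apply: to_totquot_inj.
  by rewrite !rmorphM /= -rE cE -xa; ring.
have Na : ~ nilrad R a.
  move=> Na; apply: nnI => b Ib; have [r Nr] := uab b Ib.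
  have [|Nu|//] := NM u b; last by case: Mu; exact: (nilrad_sub_prime primeM).
  rewrite -(subrK (a * r) (u * b)); apply: (idealD (nilrad_ideal R)) => //.
  by apply: (idealMr _ (nilrad_ideal R)).
exists a, u; split=> // b Ib; have [r /(nilrad_divisible hR Na)[z zE]] := uab b Ib.
by exists (r + z); rewrite mulrDr -zE; ring.
Qed.

(** Non-nilpotent dominating elements are regular in [phi R], which makes [u / a]
    an element of the inverse of [phi I]. *)
Lemma dominated_phi_invertible (I : set R) :
  (forall M, is_maximal M -> exists a u, [/\ I a, ~ nilrad R a, ~ M u
      & forall b, I b -> exists z, u * b = a * z]) ->
  is_phi_invertible hR I.
Proof.
move=> domI; apply/seteqP; split.
  apply: smallest_sub.
    split=> [|c _ _ [x _ <-] [y _ <-]]; first by exists 0; rewrite ?rmorph0.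
    by exists (c * x + y); rewrite ?rmorphD ?rmorphM.
  move=> _ [_ [b Ib <-] [x invx <-]].
  by rewrite mulrC; exact: invx.
pose S := submod_mul (tq @` @phi_ideal R hR I) (ideal_inv (@phi_ideal R hR I)).
have smS : is_submod S.
  split=> [J [smJ _]|c x y Sx Sy J smJ]; first by case: smJ.
  by have [[_ closedJ] _] := smJ; apply: closedJ; [apply: Sx | apply: Sy].
suff S1 : S (tq (ph 1)).
  move=> _ [y _ <-]; have [S0 SD] := smS.
  rewrite -[tq y]mulr1 -(rmorph1 tq) -(rmorph1 ph) -[_ * _]addr0.
  exact: SD.
pose K := [set v | S (tq (ph v))].
suff : K 1 by [].
apply: ideal_local_one => [|M maxM].
  have [S0 SD] := smS; split=> [|c x y Kx Ky]; rewrite /K /= ?rmorph0 //.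
  by rewrite !(rmorphD, rmorphM); exact: SD.
have [a [u [Ia Na Mu uI]]] := domI M maxM; exists u => //.
pose x : totquot (phiR hR) := mkloc (ph u) (to_rimage_regular Na).
apply: sub_gen_smallest; exists (tq (ph a)); first by exists (ph a) => //; exists a.
have xaE z v : u * v = a * z -> x * tq (ph v) = tq (ph z).
  move=> uvE; rewrite mklocM; apply/mkloc_eq; exists 1; first exact: mset1.
  by rewrite !mul1r mulr1 -!rmorphM uvE.
exists x; last by rewrite mulrC; apply: xaE; rewrite mulrC.
by move=> _ [b /uI[z /xaE E] <-]; exists (ph z) => //; exact: esym E.
Qed.

End Phi.

Theorem theorem2p8 (R : comNzRingType) (hR : is_phi_ring R) :
  [<-> is_phi_Prufer hR;
       forall I : set R, is_ideal I -> is_fg I -> is_nonnil I ->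
         locally_principal I;
       forall f : {poly R}, ~ nilrad {poly R} f -> is_gaussian f;
       forall f g : {poly R}, ~ nilrad {poly R} f -> ~ nilrad {poly R} g ->
         content (f * g) = ideal_mul (content f) (content g)].
Proof.
tfae.
- move=> prufer I idI fgI nnI; apply: dominated_locally_principal => //.
  by apply: (phi_invertible_dominated idI nnI); exact: prufer.
- move=> locp f nnf g.
  have nnc : ~ content f `<=` nilrad R.
    by move=> /nilpotent_of_coefs.
  apply: locally_dominated_gaussian => //; first exact: nilrad_prime.
  have idc := ideal_gen_ideal [set` (f : seq R)].
  have fgc : is_fg (content f) by exists f.
  by apply: locally_principal_dominated => //; exact: locp.
- by move=> gauss f g nnf _; exact: gauss.
move=> content_mul I idI [s sE] nnI.
apply: dominated_phi_invertible => M maxM.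
have primeM := is_maximal_prime maxM.
have nns : exists2 b, b \in s & ~ nilrad R b.
  apply: contrapT => nils; apply: nnI; rewrite sE.
  apply: ideal_gen_sub; first exact: nilrad_ideal.
  by move=> b bs; apply: contrapT => Nb; apply: nils; exists b.
have [a [u [as_ Na Mu us]]] := dominating_generator hR content_mul primeM nns.
have [b bs|v Mv vI] := @fg_uniform_denominator R M a s primeM.
  by exists u => //; exact: us.
exists a, v; split=> //; first by rewrite sE; exact: sub_ideal_gen.
by move=> b; rewrite sE; exact: vI.
Qed.
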